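(* Let $(X,d)$ be a nonempty metric space with finite distance set $D=d(X\times X)$. Suppose that there exists $r\in D$ such that the threshold relation $R_r^X$ is connected over $X$ and separating over $X$. If $$(X,d)\cong P_1\times_\infty\cdots\times_\infty P_m\quad\text{and}\quad (X,d)\cong Q_1\times_\infty\cdots\times_\infty Q_n$$ are finite decompositions in which every factor $P_i$ and every factor $Q_j$ is $\ell^\infty$-prime, then $m=n$, and after reindexing $P_i$ and $Q_i$ are isometric for every $1\leq i\leq m$.
   Context: All metric spaces are nonempty and all isometries are bijective; $\cong$ means isometric. $P_1\times_\infty\cdots\times_\infty P_m$ carries the max product metric $\max_jd_j(p_j,q_j)$. A metric space $X$ is $\ell^\infty$-prime if $|X|>1$ and every isometry $X\cong Y\times_\infty Z$ forces $|Y|=1$ or $|Z|=1$. For $r\geq0$, $R_r^X(x,y)\iff d(x,y)\leq r$. $R_r^X$ is connected over $X$ if for all distinct $x,y\in X$ there is a finite sequence $x=x_0,\dots,x_n=y$ with $R_r^X(x_i,x_{i+1})$ for all $0\le i<n$; it is separating over $X$ if for all distinct $x,y\in X$ there is $z\in X$ such that exactly one of $R_r^X(z,x)$, $R_r^X(z,y)$ holds. *)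

(* Defs.v *)
From HB Require Import structures.
From mathcomp Require Import all_boot all_order all_algebra.
From mathcomp Require Import boolp classical_sets cardinality reals topology.

Set Implicit Arguments.
Unset Strict Implicit.
Unset Printing Implicit Defensive.

Import Order.TTheory GRing.Theory Num.Theory.

Local Open Scope classical_set_scope.
Local Open Scope ring_scope.

(* The library's pseudometric on [Y * Z] already has the max balls; it only
   lacks the distance. *)
Section ProdMetric.
Context {R : realType} (Y Z : metricType R).
Implicit Types p q : Y * Z.

Let dist p q := Num.max (mdist p.1 q.1) (mdist p.2 q.2).

Let dist_ge0 p q : 0 <= dist p q.
Proof. by rewrite le_max mdist_ge0. Qed.

Let dist_positivity p q : dist p q = 0 -> p = q.
Proof.
move=> d0; have: dist p q <= 0 by rewrite d0.
rewrite ge_max => /andP[le1 le2].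
case: p q le1 le2 {d0} => [p1 p2] [q1 q2] /= le1 le2.
by congr (_, _); apply: mdist_positivity; apply/eqP; rewrite eq_le mdist_ge0 andbT.
Qed.

Let ballE p (e : R) : ball p e = [set q | dist p q < e].
Proof.
apply/seteqP; split=> q.
  by case; rewrite !ballEmdist /= gt_max => -> ->.
by rewrite /= gt_max => /andP[l1 l2]; split; rewrite ballEmdist.
Qed.

HB.instance Definition _ := @PseudoMetric_isMetric.Build R (Y * Z)%type
  dist dist_ge0 dist_positivity ballE.

End ProdMetric.

(* For m = 0 this is the one-point space. *)
Definition maxprod (R : realType) (m : nat) (P : 'I_m -> metricType R) : Type :=
  forall i, P i.

Section MaxProd.
Context {R : realType} (m : nat) (P : 'I_m -> metricType R).
Implicit Types p q : maxprod P.

HB.instance Definition _ := gen_eqMixin (maxprod P).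
HB.instance Definition _ := gen_choiceMixin (maxprod P).

(* Distances are nonnegative, so the unit 0 only matters when m = 0. *)
Let dist p q : R := \big[Num.max/0]_(i < m) mdist (p i) (q i).

Let distxx p : dist p p = 0.
Proof.
rewrite /dist; elim/big_ind: _ => // [x y -> ->|i _]; first by rewrite maxxx.
exact: mdistxx.
Qed.

Let le_dist p q i : mdist (p i) (q i) <= dist p q.
Proof. by rewrite /dist (bigD1 i) //= le_max lexx. Qed.

Let dist_ge0 p q : 0 <= dist p q.
Proof.
rewrite /dist; elim/big_ind: _ => // [x y x0 _|i _]; first by rewrite le_max x0.
exact: mdist_ge0.
Qed.

Let dist_positivity p q : dist p q = 0 -> p = q.
Proof.
move=> d0; apply: functional_extensionality_dep => i.
by apply: mdist_positivity; apply/eqP; rewrite eq_le mdist_ge0 andbT -d0 le_dist.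
Qed.

Let dist_sym p q : dist p q = dist q p.
Proof. by apply: eq_bigr => i _; rewrite metric_sym. Qed.

Let dist_triangle q p s : dist p s <= dist p q + dist q s.
Proof.
rewrite [leLHS]/dist; elim/big_ind: _ => [|x y lx ly|i _].
- by rewrite addr_ge0.
- by rewrite ge_max lx.
- by rewrite (le_trans (metric_triangle _ (q i) _))// lerD.
Qed.

HB.instance Definition _ := @isMetric.Build R (maxprod P)
  dist distxx dist_positivity dist_sym dist_triangle.

End MaxProd.

Section MetricDefs.
Context {R : realType}.

Definition isometry (X Y : metricType R) (f : X -> Y) : Prop :=
  bijective f /\ forall x y, mdist (f x) (f y) = mdist x y.

Definition isometric (X Y : metricType R) : Prop :=
  exists f : X -> Y, isometry f.

(* A [metricType] may be empty, but a [Y * Z] isometric to the nonempty [X]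
   has nonempty factors. *)
Definition linf_prime (X : metricType R) : Prop :=
  (exists x y : X, x <> y) /\
  forall Y Z : metricType R, isometric X (Y * Z)%type ->
    (exists y : Y, [set: Y] = [set y]) \/ (exists z : Z, [set: Z] = [set z]).

Definition dist_set (X : metricType R) : set R :=
  [set mdist x y | x in [set: X] & y in [set: X]].

Definition threshold (X : metricType R) (r : R) : rel X :=
  fun x y => mdist x y <= r.

End MetricDefs.

Definition rel_connected (T : Type) (E : rel T) : Prop :=
  forall x y : T, x <> y -> exists s : seq T, path E x s /\ last x s = y.

Definition rel_separating (T : Type) (E : rel T) : Prop :=
  forall x y : T, x <> y -> exists z : T, E z x (+) E z y.

(* Main.v *)
Require Import Defs.
From HB Require Import structures.
From mathcomp Require Import all_boot all_order all_algebra.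
From mathcomp Require Import boolp classical_sets cardinality reals topology.

(** Any two product decompositions of a reflexive symmetric relation E that is
    connected and separating have a common refinement (a theorem of McKenzie);
    primality then forces the two lists of factors to coincide.

    A decomposition of (T, E) into two factors is recorded by an operation f
    mixing the coordinates of two points.  Take a second one g, write A, B for
    the factors of f and C, D for those of g, and compare points by inclusion
    of their neighbourhoods, which separation makes antisymmetric.  If x and y
    are adjacent and agree in A, then all four corners of the C-D square they
    span agree in A ([edge_commute]): the common neighbourhood of two opposite
    corners is that of the other two ([common_nbhd_swap]), and this equality
    can be read in each of A, B, C and D.  The same method shows that if one
    side of a square of adjacent points has constant A-coordinate, so has the
    opposite side ([square_transport]).  Connectedness extends this from edges
    to all pairs: if x and y agree in A, then replacing the C-coordinate of x
    by that of y keeps the A-coordinate ([product_op_commute]).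

    In the metric space X, replacing one coordinate of a max-product
    decomposition is such an operation for every threshold, in particular for
    the connected and separating one.  Fix a point o, and let F_i and G_j be
    the copies of P_i and Q_j through o.  By commutation F_i is closed under
    replacing Q-coordinates, so for each j it is the max product of its part
    in G_j and its part with j-th coordinate that of o; since P_i is prime one
    of them is a point.  Choosing j where F_i is not constant gives that F_i is
    contained in G_j ([fiber_sub_fiber]).  By symmetry G_j is contained in some
    F_k, and distinct fibers only meet in o, so k = i and F_i = G_j.  The
    assignment of j to i is the required bijection. *)

Set Implicit Arguments.
Unset Strict Implicit.
Unset Printing Implicit Defensive.

Import Order.TTheory GRing.Theory Num.Theory.

Local Open Scope classical_set_scope.
Local Open Scope ring_scope.

(** * Decomposition operations of a relation *)

(** A product decomposition of (T, E) into two factors is encoded by the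
    operation sending x and y to the point with the first coordinate of x and
    the second coordinate of y.  The equations say that f is a rectangular
    band, i.e. comes from a bijection of T with a product of sets, and op_hom
    makes E the product relation.  Thus [f x y = y] says that x and y have the
    same first coordinate, and [f x y = x] that they have the same second
    one. *)
Record product_op (T : Type) (E : rel T) (f : T -> T -> T) : Prop := ProductOp {
  opxx : forall x, f x x = x;
  opop : forall x y z w, f (f x y) (f z w) = f x w;
  op_hom : forall x y x' y', E x x' -> E y y' -> E (f x y) (f x' y') }.

Section Commutation.
Variables (T : Type) (E : rel T).
Hypotheses (Exx : forall x, E x x) (Esym : forall x y, E x y -> E y x).
Hypothesis Esep : rel_separating E.

(** Exchanging the two factors; it halves the number of cases below. *)
Lemma product_op_flip f : product_op E f -> product_op E (fun x y => f y x).
Proof.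
by case=> fxx ff fE; split=> *; [exact: fxx | exact: ff | exact: fE].
Qed.

Lemma opl f : product_op E f -> forall x y z, f (f x y) z = f x z.
Proof. by move=> pf x y z; rewrite -{1}(opxx pf z) (opop pf). Qed.

Lemma opr f : product_op E f -> forall x y z, f x (f y z) = f x z.
Proof. by move=> pf x y z; rewrite -{1}(opxx pf x) (opop pf). Qed.

Let nbhd_le x y := forall t, E t x -> E t y.

Lemma nbhd_anti x y : nbhd_le x y -> nbhd_le y x -> x = y.
Proof.
move=> xy yx; apply: contrapT => /Esep[z].
suff -> : E z x = E z y by rewrite /= addbb.
by apply/idP/idP; [exact: xy | exact: yx].
Qed.

(** Common neighbourhoods are products of common neighbourhoods in the factors,
    so exchanging a coordinate between two points does not change them.  All
    that follows about two decompositions rests on reading such an equality,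
    coming from one of them, in the coordinates of the other. *)
Lemma common_nbhd_swap f x y t : product_op E f ->
  E t (f x y) /\ E t (f y x) <-> E t x /\ E t y.
Proof.
move=> pf; split=> -[t1 t2]; split; rewrite -(opxx pf t).
- by rewrite -(opxx pf x) -(opop pf x y y x); exact: (op_hom pf).
- by rewrite -(opxx pf y) -(opop pf y x x y); exact: (op_hom pf).
- exact: (op_hom pf).
- exact: (op_hom pf).
Qed.

Lemma op_hom_eq f a b t x y z : product_op E f -> E a x -> E b y ->
  f a b = t -> f x y = z -> E t z.
Proof. by move=> pf ax bY <- <-; exact: (op_hom pf). Qed.

(** Call A, B the factors of f and C, D those of g.  The edge from x to y has
    constant A-coordinate a, and z = g x y is a corner of its C-D square.  The
    A-coordinate t_A of t is adjacent to a, so f t x is adjacent to x and y,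
    hence to z by [common_nbhd_swap] for g: so t_A is adjacent to z_A.  In A,
    the neighbourhood of a is thus contained in that of z_A. *)
Lemma mixed_le f g x y u : product_op E f -> product_op E g -> E x y ->
  f x y = y -> nbhd_le (f x u) (f (g x y) u).
Proof.
move=> pf pg Exy fxy t tx; set z := g x y.
have sx : E (f t x) x.
  by apply: (op_hom_eq pf tx (Exx x)); rewrite // (opl pf) (opxx pf).
have sy : E (f t x) y by apply: (op_hom_eq pf tx Exy); rewrite // (opl pf).
have [sz _] := (common_nbhd_swap x y (f t x) pg).2 (conj sx sy).
by apply: (op_hom_eq pf sz tx); rewrite ?(opl pf) ?(opr pf) ?(opxx pf).
Qed.

(** The point z' = f x z is obtained from z by resetting its A-coordinate to
    that of x, so its neighbourhood lies in that of z; conversely a common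
    neighbour of x and z is adjacent to z' by [common_nbhd_swap] for f.  As x
    and z have the same C-coordinate, reading both facts in C shows that z'
    has that C-coordinate too. *)
Lemma mixed_class f g x y : product_op E f -> product_op E g -> E x y ->
  f x y = y -> g x (f x (g x y)) = f x (g x y).
Proof.
move=> pf pg Exy fxy; set z := g x y; set z' := f x z.
have z'z : nbhd_le z' z.
  by move=> t /(mixed_le pf pg Exy fxy); rewrite -/z (opxx pf).
apply: nbhd_anti => t tz'.
  have sx : E (g t x) x.
    by apply: (op_hom_eq pg tz' (Exx x)); rewrite // (opl pg) (opxx pg).
  have sz : E (g t x) z by apply: (op_hom_eq pg tz' Exy); rewrite // (opl pg).
  have [sz' _] := (common_nbhd_swap x z (g t x) pf).2 (conj sx sz).
  by apply: (op_hom_eq pg sz' tz'); rewrite ?(opl pg) ?(opr pg) ?(opxx pg).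
by apply: (op_hom_eq pg (z'z t tz') tz'); rewrite ?(opxx pg) ?(opl pg).
Qed.

(** By [mixed_class] for g and for its flip, z' = f x (g x y) has the
    C-coordinate of x and the D-coordinate of y, which determine g x y. *)
Lemma edge_commute f g x y : product_op E f -> product_op E g -> E x y ->
  f x y = y -> f x (g x y) = g x y.
Proof.
move=> pf pg Exy fxy.
have fyx : f y x = x by rewrite -fxy (opl pf) (opxx pf).
have c := mixed_class pf pg Exy fxy.
have := mixed_class pf (product_op_flip pg) (Esym Exy) fyx.
have fyz : f y (g x y) = f x (g x y) by rewrite -{1}fxy (opl pf).
rewrite /= fyz => d.
by rewrite -d -c (opl pg).
Qed.

(** Two opposite sides of a C-D square of pairwise adjacent points are x, g y x
    and u' = g x y, y.  If the A-coordinate is constant on the first, then on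
    the second it can only grow, in the sense of neighbourhoods, from u' to y.
    The point q = f y u' lies over the D-coordinate of u' by [edge_commute], so
    the comparison of u' with q only concerns the C-coordinate, where u' agrees
    with x: a common neighbour s of x and u' has to be adjacent to q.  In
    B this is clear, since q agrees with u' there; in A, as v = g y x agrees
    with x there, f s u' is a common neighbour of v and u', hence is adjacent
    to y by [common_nbhd_swap] for g. *)
Lemma square_le f g x y : product_op E f -> product_op E g -> E x y ->
  f x (g y x) = g y x -> nbhd_le (g x y) (f y (g x y)).
Proof.
move=> pf pg Exy; set u' := g x y; set v := g y x; set q := f y u' => fxv t tu'.
have Exu' : E x u' by apply: (op_hom_eq pg (Exx x) Exy); rewrite ?(opxx pg).
have Eu'y : E u' y by apply: (op_hom_eq pg Exy (Exx y)); rewrite ?(opxx pg).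
have Eu'v : E u' v by apply: (op_hom_eq pg Exy (Esym Exy)).
have gqu' : g q u' = q.
  have /= := edge_commute (product_op_flip pg) (product_op_flip pf) Eu'y.
  by rewrite (opr pg) (opxx pg); apply.
have sx : E (g t x) x.
  by apply: (op_hom_eq pg tu' (Exx x)); rewrite // (opl pg) (opxx pg).
have su' : E (g t x) u' by apply: (op_hom_eq pg tu' Exu'); rewrite // (opxx pg).
have s2v : E (f (g t x) u') v by apply: (op_hom_eq pf sx Eu'v).
have s2u' : E (f (g t x) u') u'.
  by apply: (op_hom_eq pf su' (Exx u')); rewrite // (opxx pf).
have [_ s2y] := (common_nbhd_swap x y _ pg).1 (conj s2u' s2v).
have sq : E (g t x) q.
  by apply: (op_hom_eq pf s2y su'); rewrite // (opl pf) (opxx pf).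
by apply: (op_hom_eq pg sq tu'); rewrite // (opl pg) (opxx pg).
Qed.

(** Opposite sides of a square: constancy of the A-coordinate passes from one to
    the other, by [square_le] in both directions and separation. *)
Lemma square_transport f g x y : product_op E f -> product_op E g -> E x y ->
  f x (g y x) = g y x -> f (g x y) y = y.
Proof.
move=> pf pg Exy fxv.
have uq := square_le pf pg Exy fxv.
have yp : nbhd_le y (f (g x y) y).
  have Evu : E (g y x) (g x y) by apply: (op_hom_eq pg (Esym Exy) Exy).
  have := square_le pf pg Evu; rewrite !(opop pg) !(opxx pg); apply.
  by rewrite -fxv (opl pf) (opxx pf).
apply: nbhd_anti yp => t tp; set u' := g x y in uq tp.
have /uq su : E (f t u') u'.
  by apply: (op_hom_eq pf tp (Exx u')); rewrite // (opl pf) (opxx pf).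
by apply: (op_hom_eq pf su tp); rewrite ?(opl pf) ?(opr pf) ?(opxx pf).
Qed.

(** Transport of a C-edge along a path in D: by [square_transport] constancy of
    the A-coordinate on it is preserved. *)
Lemma path_transport f g u v w s : product_op E f -> product_op E g -> E u v ->
  path E w s -> f (g u w) (g v w) = g v w ->
  f (g u (last w s)) (g v (last w s)) = g v (last w s).
Proof.
move=> pf pg Euv; elim: s w => [//|w' s IHs] w /= /andP[Eww' ws] fw.
apply: IHs ws _.
have Ex : E (g u w) (g v w') by exact: (op_hom pg).
have := square_transport pf pg Ex; rewrite !(opop pg); exact.
Qed.

Hypothesis Econn : rel_connected E.

(** The decompositions f and g commute: if x and y agree in A, then giving x the
    C-coordinate of y does not change its A-coordinate.  Along a path from x to
    y inside their A-class each edge splits, by [edge_commute], into a D-edge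
    and a C-edge in that class; [path_transport] moves the C-edges to the
    D-coordinate of x, where they form a chain from x to g y x. *)
Lemma product_op_commute f g x y : product_op E f -> product_op E g ->
  f x y = y -> f x (g y x) = g y x.
Proof.
move=> pf pg fxy.
have paths a b : exists s, path E a s /\ last a s = b.
  have [->|/Econn//] := pselect (a = b); by exists [::].
pose P b := f x (g (f x b) x) = g (f x b) x.
(* [f x] moves a path into the A-class of x. *)
have step a b : E a b -> P a -> P b.
  rewrite /P => Eab; set u := f x a; set v := f x b => Pu.
  have Euv : E u v by exact: (op_hom pf).
  have fuv : f u v = v by rewrite (opop pf).
  have fzv : f (g u v) v = v.
    by rewrite -(edge_commute pf pg Euv fuv) (opl pf).
  have [s [vs lx]] := paths v x.
  have Ezv : E (g u v) v.
    by apply: (op_hom_eq pg Euv (Exx v)); rewrite ?(opxx pg).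
  have := path_transport pf pg Ezv vs.
  rewrite {}lx !(opl pg) (opxx pg) => /(_ fzv) <-.
  by rewrite -Pu (opl pf) (opr pf).
have walk s a : path E a s -> P a -> P (last a s).
  elim: s a => [//|w s IHs] a /= /andP[Eaw ws] Pa.
  exact: IHs ws (step _ _ Eaw Pa).
have [s [xs lxs]] := paths x y; move: fxy; rewrite -lxs => fxy.
have := walk _ _ xs; rewrite /P fxy => -> //.
by rewrite !(opxx pf, opxx pg).
Qed.
End Commutation.

(** * Max-product decompositions of a metric space *)

Definition metric_sub (R : realType) (X : metricType R) (S : set X) : Type :=
  set_type S.

Section MetricSub.
Context {R : realType} (X : metricType R) (S : set X).

HB.instance Definition _ := Choice.on (metric_sub S).

Let dist (x y : metric_sub S) : R := mdist (sval x) (sval y).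

Let dist_positivity x y : dist x y = 0 -> x = y.
Proof. by move=> /mdist_positivity/val_inj. Qed.

HB.instance Definition _ := @isMetric.Build R (metric_sub S) dist
  (fun x => mdistxx (sval x)) dist_positivity
  (fun x y => metric_sym (sval x) (sval y))
  (fun y x z => metric_triangle (sval x) (sval y) (sval z)).
End MetricSub.

Section Isometry.
Context {R : realType}.

Lemma mdist_maxprodE (m : nat) (P : 'I_m -> metricType R) (p q : maxprod P) :
  mdist p q = \big[Num.max/0]_(i < m) mdist (p i) (q i).
Proof. by []. Qed.

(** Preserving all thresholds means being nonexpansive for the max metric.  So
    a decomposition operation at every threshold splits the metric as the max
    of its restrictions to the two factors through o. *)
Lemma metric_product_op_split (X : metricType R) (g : X -> X -> X) (o : X) :
  (forall r : R, 0 <= r -> product_op (threshold (X := X) r) g) ->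
  forall x y,
    mdist x y = Num.max (mdist (g o x) (g o y)) (mdist (g x o) (g y o)).
Proof.
move=> pg x y; have pg0 := pg 0 (lexx _).
apply/eqP; rewrite eq_le; apply/andP; split.
  set e := Num.max _ _.
  have e0 : 0 <= e by rewrite le_max mdist_ge0.
  rewrite -[leLHS]/(mdist x y) -(opxx pg0 x) -(opxx pg0 y).
  rewrite -(opop pg0 x o o x) -(opop pg0 y o o y).
  by apply: (op_hom (pg _ e0)); rewrite /threshold le_max lexx // orbT.
have d0 := mdist_ge0 x y; rewrite ge_max; apply/andP; split;
  by apply: (op_hom (pg _ d0)); rewrite /threshold // mdistxx.
Qed.

Section Decomposition.
Variables (X : metricType R) (m : nat) (P : 'I_m -> metricType R).
Variables (phi : X -> maxprod P) (phi' : maxprod P -> X).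
Hypotheses (phiK : cancel phi phi') (phi'K : cancel phi' phi).
Hypothesis phi_dist : forall x y, mdist (phi x) (phi y) = mdist x y.

Lemma mdist_leP x y (r : R) : 0 <= r ->
  mdist x y <= r <-> forall i, mdist (phi x i) (phi y i) <= r.
Proof.
move=> r0; rewrite -phi_dist mdist_maxprodE; split=> [le i|le].
  by apply: le_trans le; rewrite (bigD1 i) //= le_max lexx.
by elim/big_ind: _ => // a b ra rb; rewrite ge_max ra.
Qed.

Definition put i (x y : X) : X := phi' (dfwith (phi x) (phi y i)).

Lemma put_in i x y : phi (put i x y) i = phi y i.
Proof. by rewrite /put phi'K dfwith_in. Qed.

Lemma put_out i k x y : i != k -> phi (put i x y) k = phi x k.
Proof. by move=> ik; rewrite /put phi'K dfwith_out. Qed.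

Lemma coord_ext x y : (forall i, phi x i = phi y i) -> x = y.
Proof.
by move=> e; apply: (can_inj phiK); apply: functional_extensionality_dep.
Qed.

Lemma put_product_op i r : 0 <= r -> product_op (threshold (X := X) r) (put i).
Proof.
move=> r0; split=> [x|x y z w|x y x' y'].
- apply: coord_ext => k; have [<-|ik] := eqVneq i k; first exact: put_in.
  exact: put_out.
- apply: coord_ext => k.
  by have [<-|ik] := eqVneq i k; rewrite !(put_in, put_out).
- rewrite /threshold !mdist_leP// => xx' yy' k.
  by have [<-|ik] := eqVneq i k; rewrite !(put_in, put_out).
Qed.

Lemma put_flip_eq i x y : put i y x = y <-> phi x i = phi y i.
Proof.
split=> [<-|e]; first by rewrite put_in.
apply: coord_ext => k.
by have [<-|ik] := eqVneq i k; rewrite !(put_in, put_out).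
Qed.

Variable o : X.

(** The copy of the factor P i through the base point o. *)
Definition fiber i : set X := [set x | forall k, i != k -> phi x k = phi o k].

Lemma fiber_base i : fiber i o.
Proof. by []. Qed.

Definition fiber_inj i (a : P i) : X := phi' (dfwith (phi o) a).

Lemma fiber_injK i a : phi (@fiber_inj i a) i = a.
Proof. by rewrite /fiber_inj phi'K dfwith_in. Qed.

Lemma fiber_inj_fiber i a : fiber i (@fiber_inj i a).
Proof. by move=> k ik; rewrite /fiber_inj phi'K dfwith_out. Qed.

Lemma fiber_coordK i x : fiber i x -> fiber_inj (phi x i) = x.
Proof.
move=> Fx; apply: coord_ext => k; have [<-|ik] := eqVneq i k.
  exact: fiber_injK.
by rewrite (Fx _ ik) (fiber_inj_fiber _ ik).
Qed.

Lemma fiber_dist i x y : fiber i x -> fiber i y ->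
  mdist (phi x i) (phi y i) = mdist x y.
Proof.
move=> Fx Fy; apply/eqP; rewrite eq_le; apply/andP; split.
  by move: i {Fx Fy}; apply/mdist_leP; rewrite ?mdist_ge0.
apply/mdist_leP => [|k]; first exact: mdist_ge0.
have [<-//|ik] := eqVneq i k.
by rewrite Fx// Fy// mdistxx mdist_ge0.
Qed.

Lemma fiber_nontrivial i : linf_prime (P i) -> exists2 x, fiber i x & x <> o.
Proof.
move=> [[a [b ab]] _]; have [a_o|] := pselect (fiber_inj a = o); last first.
  by exists (fiber_inj a) => //; exact: fiber_inj_fiber.
exists (fiber_inj b); first exact: fiber_inj_fiber.
by move=> b_o; apply: ab; rewrite -(fiber_injK a) -(fiber_injK b) a_o b_o.
Qed.

(** The decomposition that g induces on a fiber closed under g: the fiber is the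
    max product of its parts Y and Z in the two g-slices through o, so one of
    them is a point. *)
Lemma prime_fiber_split i (g : X -> X -> X) : linf_prime (P i) ->
  (forall r : R, 0 <= r -> product_op (threshold (X := X) r) g) ->
  (forall x y, fiber i x -> fiber i y -> fiber i (g x y)) ->
  (forall x, fiber i x -> g o x = o) \/ (forall x, fiber i x -> g x o = o).
Proof.
move=> [_ prime] pg gF; have pg0 := pg 0 (lexx _).
pose Y := [set x | fiber i x /\ g x o = o].
pose Z := [set x | fiber i x /\ g o x = o].
have Fo := @fiber_base i.
have inY x : fiber i x -> g o x \in Y.
  by move=> Fx; rewrite inE; split; [exact: gF | rewrite (opl pg0) (opxx pg0)].
have inZ x : fiber i x -> g x o \in Z.
  by move=> Fx; rewrite inE; split; [exact: gF | rewrite (opr pg0) (opxx pg0)].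
have F a := @fiber_inj_fiber i a.
pose toY x (Fx : fiber i x) : metric_sub Y :=
  exist (fun x => x \in Y) _ (inY _ Fx).
pose toZ x (Fx : fiber i x) : metric_sub Z :=
  exist (fun x => x \in Z) _ (inZ _ Fx).
pose h (a : P i) : (metric_sub Y * metric_sub Z)%type :=
  (toY _ (F a), toZ _ (F a)).
pose h' (p : (metric_sub Y * metric_sub Z)%type) : P i :=
  phi (g (sval p.2) (sval p.1)) i.
have [|[y Yy]|[z Zz]] := prime (metric_sub Y) (metric_sub Z).
- exists h; split.
    exists h' => [a|[[y yY] [z zZ]]].
      rewrite /h' /h /= (opop pg0) (opxx pg0); exact: fiber_injK.
    have [Fy gy] := set_mem yY; have [Fz gz] := set_mem zZ.
    have Fzy := gF _ _ Fz Fy.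
    congr (_, _); apply: val_inj; rewrite /= /h' /= fiber_coordK//.
      by rewrite (opr pg0) -{1}gy (opl pg0) (opxx pg0).
    by rewrite (opl pg0) -gz (opr pg0) (opxx pg0).
  move=> a b; rewrite -(fiber_injK a) -(fiber_injK b).
  rewrite (fiber_dist (F a) (F b)) !fiber_injK.
  by rewrite (metric_product_op_split o pg).
- left=> x Fx.
  have e w (Fw : fiber i w) : toY _ Fw = y.
    by have : [set: metric_sub Y] (toY _ Fw) by []; rewrite Yy.
  have := etrans (e _ Fx) (esym (e _ Fo)).
  by move=> /(congr1 val) /= ->; rewrite (opxx pg0).
- right=> x Fx.
  have e w (Fw : fiber i w) : toZ _ Fw = z.
    by have : [set: metric_sub Z] (toZ _ Fw) by []; rewrite Zz.
  have := etrans (e _ Fx) (esym (e _ Fo)).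
  by move=> /(congr1 val) /= ->; rewrite (opxx pg0).
Qed.

(** Distinct fibers meet only in o. *)
Lemma fiber_sub_inj i k : linf_prime (P i) -> fiber i `<=` fiber k -> i = k.
Proof.
move=> prime sub; have [x Fx xo] := fiber_nontrivial prime.
have [//|ik] := eqVneq i k; case: xo; apply: coord_ext => l.
have [<-|il] := eqVneq i l; last exact: Fx.
by apply: (sub x Fx); rewrite eq_sym.
Qed.
End Decomposition.

Section TwoDecompositions.
Variables (X : metricType R) (m n : nat).
Variables (P : 'I_m -> metricType R) (Q : 'I_n -> metricType R).
Variables (phi : X -> maxprod P) (phi' : maxprod P -> X).
Variables (psi : X -> maxprod Q) (psi' : maxprod Q -> X).
Hypotheses (phiK : cancel phi phi') (phi'K : cancel phi' phi).
Hypotheses (psiK : cancel psi psi') (psi'K : cancel psi' psi).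
Hypothesis phi_dist : forall x y, mdist (phi x) (phi y) = mdist x y.
Hypothesis psi_dist : forall x y, mdist (psi x) (psi y) = mdist x y.
Variable o : X.

Section Refinement.
Variable r : R.
Hypothesis r0 : 0 <= r.
Hypothesis r_conn : rel_connected (threshold (X := X) r).
Hypothesis r_sep : rel_separating (threshold (X := X) r).

(** [product_op_commute] for the decompositions of X into P k and the other
    factors, and into Q j and the other factors. *)
Lemma put_keeps_coord j k x y :
  phi x k = phi y k -> phi (put psi psi' j x y) k = phi x k.
Proof.
move=> e.
have thxx z : threshold (X := X) r z z by rewrite /threshold mdistxx.
have thC (z t : X) : threshold r z t -> threshold r t z.
  by rewrite /threshold metric_sym.
have pf := product_op_flip (put_product_op phiK phi'K phi_dist k r0).
have pg := product_op_flip (put_product_op psiK psi'K psi_dist j r0).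
have := product_op_commute thxx thC r_sep r_conn pf pg.
move=> /(_ x y) /(_ ((put_flip_eq phiK phi'K k x y).2 e)).
by move=> /(put_flip_eq phiK phi'K) ->.
Qed.

(** By [put_keeps_coord] the fiber F of P i is closed under replacing the j-th
    Q-coordinate, for every j.  For a j at which F is not constant, primality
    leaves no room for variation in the other Q-coordinates. *)
Lemma fiber_sub_fiber i :
  linf_prime (P i) -> exists j, fiber phi o i `<=` fiber psi o j.
Proof.
move=> prime; have [x Fx xo] := fiber_nontrivial phi'K o prime.
have [j xj] : exists j, psi x j <> psi o j.
  apply: contrapT => nj; apply: xo; apply: (coord_ext psiK) => j.
  by apply: contrapT => xj; apply: nj; exists j.
exists j => y Fy.
have pg s (s0 : 0 <= s) := put_product_op psiK psi'K psi_dist j s0.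
have gF u v : fiber phi o i u -> fiber phi o i v ->
    fiber phi o i (put psi psi' j u v).
  by move=> Fu Fv k ik; rewrite put_keeps_coord Fu// Fv.
have [gx|gx] := prime_fiber_split phiK phi'K phi_dist prime pg gF.
  by case: xj; rewrite -[in RHS](gx _ Fx) put_in.
by move=> l jl; rewrite -(gx _ Fy) put_out.
Qed.

End Refinement.

Lemma fiber_eq_isometric i j :
  fiber phi o i = fiber psi o j -> isometric (P i) (Q j).
Proof.
move=> FG.
have F (a : P i) : fiber psi o j (fiber_inj phi phi' o a).
  by rewrite -FG; exact: (fiber_inj_fiber phi'K).
have G (b : Q j) : fiber phi o i (fiber_inj psi psi' o b).
  by rewrite FG; exact: (fiber_inj_fiber psi'K).
exists (fun a => psi (fiber_inj phi phi' o a) j); split.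
  exists (fun b => phi (fiber_inj psi psi' o b) i) => [a|b].
    by rewrite (fiber_coordK psiK psi'K)// fiber_injK.
  by rewrite (fiber_coordK phiK phi'K)// fiber_injK.
have F' a := fiber_inj_fiber phi'K o (i := i) a.
move=> a b; rewrite (fiber_dist psi_dist (F a) (F b)).
by rewrite -(fiber_dist phi_dist (F' a) (F' b)) !fiber_injK.
Qed.

End TwoDecompositions.
End Isometry.

(** * Uniqueness of the prime factorization *)

Theorem theorem4p64 (R : realType) (X : metricType R)
    (X_nonempty : [set: X] !=set0)
    (finD : finite_set (dist_set X))
    (thr : exists r : R, [/\ dist_set X r,
        rel_connected (threshold (X := X) r) &
        rel_separating (threshold (X := X) r)])
    (m n : nat) (P : 'I_m -> metricType R) (Q : 'I_n -> metricType R)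
    (P_prime : forall i, linf_prime (P i))
    (Q_prime : forall j, linf_prime (Q j))
    (X_P : isometric X (maxprod P))
    (X_Q : isometric X (maxprod Q)) :
  m = n /\
  exists s : 'I_m -> 'I_n, bijective s /\ forall i, isometric (P i) (Q (s i)).
Proof.
have [o _] := X_nonempty.
have [r [[x _ [y _ dxy]] conn sep]] := thr.
have r0 : 0 <= r by rewrite -dxy mdist_ge0.
have [phi [[phi' phiK phi'K] phiD]] := X_P.
have [psi [[psi' psiK psi'K] psiD]] := X_Q.
(* Fibers of either decomposition are contained in fibers of the other, and
   distinct fibers of one decomposition are not nested. *)
have [s Fs] := choice (fun i =>
  fiber_sub_fiber phiK phi'K psiK psi'K phiD psiD o r0 conn sep (P_prime i)).
have [t Gt] := choice (fun j =>
  fiber_sub_fiber psiK psi'K phiK phi'K psiD phiD o r0 conn sep (Q_prime j)).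
have sK : cancel s t.
  move=> i; apply/esym/(fiber_sub_inj (o := o) phiK phi'K (P_prime i)).
  exact: subset_trans (Fs i) (Gt _).
have tK : cancel t s.
  move=> j; apply/esym/(fiber_sub_inj (o := o) psiK psi'K (Q_prime j)).
  exact: subset_trans (Gt j) (Fs _).
have s_bij : bijective s by exists t.
split; first by have := bij_eq_card s_bij; rewrite !card_ord.
exists s; split=> // i.
apply: (fiber_eq_isometric phiK phi'K psiK psi'K phiD psiD (o := o)).
by apply/seteqP; split=> //; rewrite -{2}(sK i).
Qed.
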